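(* Let $(X,T)$ be a topological dynamical system (t.d.s.). The following statements are equivalent: (1) $(X,T)$ is equicontinuous; (2) $(K(X),T_K)$ is equicontinuous; (3) $(K(X),T_K)$ is distal; (4) $(K(X),T_K)$ is pointwise minimal.
   Context: A t.d.s. is a pair $(X,T)$ with $X$ a compact metric space (metric $d$) and $T:X\to X$ a continuous surjective map (not assumed injective). $K(X)$ is the set of non-empty closed subsets of $X$ with the Hausdorff metric $d_H$ (a compact metric space), and $T_K:K(X)\to K(X)$, $T_K(A)=T(A)$; $(K(X),T_K)$ is again a t.d.s. The following notions apply to any t.d.s. $(X,T)$. The orbit of $x$ is $\mathrm{orb}(x,T)=\{T^m x: m\ge 0\}$. $(X,T)$ is minimal if every point has dense orbit. A point $x$ is minimal if the subsystem $(\overline{\mathrm{orb}(x,T)},T)$ is minimal. $(X,T)$ is pointwise minimal if all its points are minimal. A pair $(x,y)$ is proximal if there is a sequence $n_i\to+\infty$ with $d(T^{n_i}x,T^{n_i}y)\to 0$. $(X,T)$ is distal if every proximal pair $(x,y)$ satisfies $x=y$. A point $x$ is an equicontinuous point if for each $\varepsilon>0$ there is $\delta>0$ such that $\mathrm{diam}\, T^n(B(x,\delta))<\varepsilon$ for every $n\ge 0$, where $B(x,\delta)$ is the open ball; $(X,T)$ is equicontinuous if all points are equicontinuous points. *)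

(* Defs.v *)
From HB Require Import structures.
From mathcomp Require Import all_boot all_order all_algebra.
From mathcomp Require Import all_classical all_reals all_analysis.

Set Implicit Arguments.
Unset Strict Implicit.
Unset Printing Implicit Defensive.

Import Order.TTheory GRing.Theory Num.Theory.
Import numFieldNormedType.Exports.

Local Open Scope classical_set_scope.
Local Open Scope ring_scope.

HB.mixin Record Metric_isCompact (R : realType) T & Metric R T := {
  compact_setT : compact [set: T]
}.

#[short(type="compactMetricType")]
HB.structure Definition CompactMetric (R : realType) :=
  { T of Metric R T & Metric_isCompact R T }.

Record tds (R : realType) := TDS {
  tds_space :> compactMetricType R ;
  tmap : tds_space -> tds_space ;
  tmap_continuous : continuous tmap ;
  tmap_surj : range tmap = [set: tds_space]
}.

Arguments tmap {R} S x : rename.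
Arguments tmap_continuous {R} S : rename.
Arguments tmap_surj {R} S : rename.

Record hyperspace (R : realType) (X : compactMetricType R) := Hyperspace {
  hset :> set X ;
  hset_closed : closed hset ;
  hset_neq0 : hset !=set0
}.

Arguments hset_closed {R X} h.
Arguments hset_neq0 {R X} h.

HB.instance Definition _ (R : realType) (X : compactMetricType R) :=
  gen_eqMixin (hyperspace X).
HB.instance Definition _ (R : realType) (X : compactMetricType R) :=
  gen_choiceMixin (hyperspace X).

Section hausdorff_distance.
Context {R : realType} {X : compactMetricType R}.
Implicit Types (A B C : hyperspace X) (x y : X) (e r : R).

Lemma hyperspace_inj A B : hset A = hset B -> A = B.
Proof.
case: A B => [A cA A0] [B cB B0] /= AB; rewrite -AB in cB B0 *.
by congr Hyperspace; exact: Prop_irrelevance.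
Qed.

Definition fatten (A : set X) e : set X :=
  [set x | exists2 a, A a & mdist a x < e].

(* The set below is nonempty because X is bounded, so that the infimum is not a
   default value. *)
Definition hausdorff_dist A B : R :=
  inf [set e | [/\ 0 < e, A `<=` fatten B e & B `<=` fatten A e]].

Lemma compact_metric_bounded :
  exists2 M : R, 0 < M & forall x y, mdist x y < M.
Proof.
have [[p _]|X0] := pselect ([set: X] !=set0); last first.
  by exists 1 => // x; exfalso; apply: X0; exists x.
have /compact_near_coveringP/(_ R +oo (fun M x => mdist p x < M)) :=
  @compact_setT R X.
case.
- move=> x _; exists (ball x 1, [set M | mdist p x + 1 < M]) => /=.
    split; first exact: nbhsx_ballx.
    exact: nbhs_pinfty_gt (num_real _).
  move=> [x' M]/= []; rewrite ballEmdist /= => xx' pM.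
  rewrite (le_lt_trans (metric_triangle p x x'))// (lt_trans _ pM)//.
  by rewrite ltrD2l.
- move=> M [_ MP].
  have pM y : mdist p y < `|M| + 1 by apply: MP => //;
    rewrite (le_lt_trans (ler_norm M))// ltrDl.
  exists ((`|M| + 1) + (`|M| + 1)); first by rewrite addr_gt0// ltr_wpDl.
  move=> x y; rewrite (le_lt_trans (metric_triangle x p y))// ltrD//.
  by rewrite metric_sym.
Qed.

Let admissible A B := [set e | [/\ 0 < e, A `<=` fatten B e & B `<=` fatten A e]].

Let admissible_has_inf A B : has_inf (admissible A B).
Proof.
split; last by exists 0 => e [/ltW].
have [M M0 MP] := compact_metric_bounded.
have [a Aa] := hset_neq0 A; have [b Bb] := hset_neq0 B.
by exists M; split => // x _; [exists b|exists a].
Qed.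

Lemma fatten_le (A : set X) e r : e <= r -> fatten A e `<=` fatten A r.
Proof. by move=> er x [a Aa ax]; exists a => //; exact: lt_le_trans er. Qed.

Lemma hausdorff_dist_le A B e : 0 < e ->
  A `<=` fatten B e -> B `<=` fatten A e -> hausdorff_dist A B <= e.
Proof.
by move=> e0 AB BA; apply: ge_inf => //; have [] := admissible_has_inf A B.
Qed.

Lemma hausdorff_dist_lt A B e : hausdorff_dist A B < e ->
  [/\ 0 < e, A `<=` fatten B e & B `<=` fatten A e].
Proof.
have [AB0 _] := admissible_has_inf A B.
move=> /(inf_lt AB0)[r [r0 AB BA]] /[dup] re /ltW re'; split.
- exact: lt_trans re.
- exact: subset_trans AB (fatten_le re').
- exact: subset_trans BA (fatten_le re').
Qed.

Lemma hausdorff_dist_ge0 A B : 0 <= hausdorff_dist A B.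
Proof.
have [AB0 _] := admissible_has_inf A B.
by apply: lb_le_inf => // e [/ltW].
Qed.

Lemma hausdorff_distxx A : hausdorff_dist A A = 0.
Proof.
apply/eqP; rewrite eq_le hausdorff_dist_ge0 andbT; apply/ler_addgt0Pl => e e0.
by rewrite addr0 hausdorff_dist_le// => x Ax; exists x; rewrite // mdistxx.
Qed.

Lemma closed_fatten (A : set X) x :
  closed A -> (forall e, 0 < e -> fatten A e x) -> A x.
Proof.
move=> cA Ax; apply: cA => U /nbhs_ballP[e/= e0 eU].
have [a Aa ax] := Ax e e0; exists a; split => //; apply: eU.
by rewrite ballEmdist /= metric_sym.
Qed.

Lemma hausdorff_dist_positivity A B : hausdorff_dist A B = 0 -> A = B.
Proof.
move=> AB0; apply: hyperspace_inj; apply/seteqP; split => x Hx.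
- apply: (closed_fatten (hset_closed B)) => e e0.
  by have [|_ + _] := @hausdorff_dist_lt A B e; [rewrite AB0|exact].
- apply: (closed_fatten (hset_closed A)) => e e0.
  by have [|_ _ ] := @hausdorff_dist_lt A B e; [rewrite AB0|exact].
Qed.

Lemma hausdorff_dist_sym A B : hausdorff_dist A B = hausdorff_dist B A.
Proof. by congr inf; apply/seteqP; split => e [e0 H1 H2]; split. Qed.

Lemma fatten_trans (A B C : set X) e r :
  A `<=` fatten B e -> B `<=` fatten C r -> A `<=` fatten C (e + r).
Proof.
move=> AB BC a /AB[b /BC[c Cc cb] ba]; exists c => //.
by rewrite (le_lt_trans (metric_triangle c b a))// addrC ltrD.
Qed.

Lemma hausdorff_dist_triangle B A C :
  hausdorff_dist A C <= hausdorff_dist A B + hausdorff_dist B C.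
Proof.
apply/ler_addgt0Pl => e e0.
have e20 : 0 < e / 2 by rewrite divr_gt0.
have [|d0 AB BA] := @hausdorff_dist_lt A B (hausdorff_dist A B + e / 2).
  by rewrite ltrDl.
have [|r0 BC CB] := @hausdorff_dist_lt B C (hausdorff_dist B C + e / 2).
  by rewrite ltrDl.
have -> : e + (hausdorff_dist A B + hausdorff_dist B C) =
    (hausdorff_dist A B + e / 2) + (hausdorff_dist B C + e / 2).
  by rewrite [RHS]addrACA -splitr addrC.
apply: hausdorff_dist_le; [exact: addr_gt0|exact: fatten_trans AB BC|].
by rewrite addrC; exact: fatten_trans CB BA.
Qed.

End hausdorff_distance.

HB.instance Definition _ (R : realType) (X : compactMetricType R) :=
  @isMetric.Build R (hyperspace X) hausdorff_dist
    hausdorff_distxx hausdorff_dist_positivity hausdorff_dist_sym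
    hausdorff_dist_triangle.

Section hyperspace_compact.
Context {R : realType} {X : compactMetricType R}.

Lemma mdist_hyperspace (A B : hyperspace X) : mdist A B = hausdorff_dist A B.
Proof. by []. Qed.

Lemma hyperspace_compact : compact [set: hyperspace X].
Proof.
rewrite compact_ultra => F FU _.
pose L := [set x : X | forall e : R, 0 < e ->
  F [set B : hyperspace X | fatten B e x]].
have Lclosed : closed L.
  move=> x Lx e e0; have e20 : 0 < e / 2 by rewrite divr_gt0.
  have [y [Ly]] := Lx _ (nbhsx_ballx x _ e20).
  rewrite ballEmdist /= => xy.
  apply: filterS (Ly _ e20) => B [b Bb bz]; exists b => //.
  rewrite (le_lt_trans (metric_triangle b y x))// [e]splitr ltrD//.
  by rewrite metric_sym.
have subL (e : R) : 0 < e -> \forall B \near F, hset B `<=` fatten L e.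
  move=> e0; have /compact_near_coveringP := @compact_setT R X.
  move=> /(_ _ F (fun B x => hset B x -> fatten L e x)) H.
  have : \forall B \near F, [set: X] `<=` (fun x => hset B x -> fatten L e x).
    apply: H => x _; have [Lx|] := pselect (L x).
      exists (ball x e, setT) => /=.
        by split; [exact: nbhsx_ballx|exact: filterT].
      by move=> [y B]/= [+ _] _; rewrite ballEmdist /= => xy; exists x.
    move=> /existsNP[r /not_implyP[r0 nF]].
    have [//|FC] := in_ultra_setVsetC [set B : hyperspace X | fatten B r x] FU.
    exists (ball x r, ~` [set B : hyperspace X | fatten B r x]) => /=.
      by split => //; exact: nbhsx_ballx.
    move=> [y B]/= []; rewrite ballEmdist /= => xy nB By.
    by exfalso; apply: nB; exists y; rewrite // metric_sym.
  by apply: filterS => B HB x; exact: HB.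
have Lneq0 : L !=set0.
  have [B BL] := filter_ex (subL 1 ltr01).
  by have [b /BL[x Lx _]] := hset_neq0 B; exists x.
have Lsub (e : R) : 0 < e -> \forall B \near F, L `<=` fatten (hset B) e.
  move=> e0; have e20 : 0 < e / 2 by rewrite divr_gt0.
  have cL : compact L.
    exact: (subclosed_compact Lclosed (@compact_setT R X)).
  move: cL => /compact_near_coveringP.
  move=> /(_ _ F (fun B x => fatten (hset B) e x)); apply => x Lx.
  exists (ball x (e / 2), [set B | fatten (hset B) (e / 2) x]) => /=.
    by split; [exact: nbhsx_ballx|exact: Lx].
  move=> [y B]/= []; rewrite ballEmdist /= => xy [b Bb bx]; exists b => //.
  by rewrite (le_lt_trans (metric_triangle b x y))// [e]splitr ltrD.
exists (Hyperspace Lclosed Lneq0); split => //=.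
apply/metricType_numDomainType.fcvgrPdist_lt => e e0.
have e20 : 0 < e / 2 by rewrite divr_gt0.
apply: filterS2 (subL _ e20) (Lsub _ e20) => B BL LB.
rewrite (@le_lt_trans _ _ (e / 2))//; last by rewrite ltr_pdivrMr// ltr_pMr// ltr1n.
exact: hausdorff_dist_le.
Qed.

End hyperspace_compact.

HB.instance Definition _ (R : realType) (X : compactMetricType R) :=
  Metric_isCompact.Build R (hyperspace X) hyperspace_compact.

Section induced_system.
Context {R : realType} (S : tds R).
Implicit Types A B : hyperspace S.

Lemma image_closed A : closed (tmap S @` A).
Proof.
apply: compact_closed; first exact: metric_hausdorff.
apply: continuous_compact; first exact/continuous_subspaceT/(tmap_continuous S).
exact: (subclosed_compact (hset_closed A) (@compact_setT R S)).
Qed.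

Lemma image_neq0 A : tmap S @` A !=set0.
Proof. exact/image_nonempty/hset_neq0. Qed.

Definition hmap A : hyperspace S :=
  Hyperspace (@image_closed A) (@image_neq0 A).

Lemma tmap_unif (e : R) : 0 < e -> exists2 d : R, 0 < d &
  forall x y : S, mdist x y < d -> mdist (tmap S x) (tmap S y) < e.
Proof.
move=> e0; have e20 : 0 < e / 2 by rewrite divr_gt0.
have /compact_near_coveringP := @compact_setT R S.
move=> /(_ _ (0^'+ : set_system R) (fun d x => forall y : S, mdist x y < d ->
  mdist (tmap S x) (tmap S y) < e)) H.
have : \forall d \near 0^'+, [set: S] `<=` (fun x => forall y : S, mdist x y < d ->
    mdist (tmap S x) (tmap S y) < e).
  apply: H => x _.
  have /metricType_numDomainType.cvgrPdist_lt/(_ _ e20) := tmap_continuous S x.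
  move=> /nbhs_ballP[r /= r0 rT].
  have r20 : 0 < r / 2 by rewrite divr_gt0.
  exists (ball x (r / 2), [set d | d < r / 2]) => /=.
    by split; [exact: nbhsx_ballx|exact: nbhs_right_lt].
  move=> [z d]/= []; rewrite ballEmdist /= => xz dr y zy.
  rewrite (le_lt_trans (metric_triangle _ (tmap S x) _))// [e]splitr ltrD//.
    rewrite metric_sym; apply: rT; rewrite ballEmdist /=.
    by rewrite (lt_le_trans xz)// ler_pdivrMr// ler_pMr// ler1n.
  apply: rT; rewrite ballEmdist /=.
  by rewrite (le_lt_trans (metric_triangle _ z _))// [r]splitr ltrD// (lt_trans zy).
move=> /(filterI (nbhs_right_gt (0 : R))) /filter_ex[d [/= d0 dT]].
by exists d => // x y; exact: dT.
Qed.

Lemma hmap_continuous : continuous hmap.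
Proof.
move=> A.
apply/(@metricType_numDomainType.cvgrPdist_lt _ _ _ _ (nbhs_filter A)) => e e0.
have e20 : 0 < e / 2 by rewrite divr_gt0.
have [d d0 dT] := tmap_unif e20.
apply/nbhs_ballP; exists d => //= B; rewrite ballEmdist /= mdist_hyperspace.
move=> /hausdorff_dist_lt[_ AB BA].
rewrite (@le_lt_trans _ _ (e / 2))//; last by rewrite ltr_pdivrMr// ltr_pMr// ltr1n.
apply: hausdorff_dist_le => //= _ [x xP <-].
- by have [b Bb bx] := AB _ xP; exists (tmap S b); [exists b|exact: dT].
- by have [b Bb bx] := BA _ xP; exists (tmap S b); [exists b|exact: dT].
Qed.

Lemma hmap_surj : range hmap = [set: hyperspace S].
Proof.
apply/seteqP; split => // B _.
have cB : closed (tmap S @^-1` B).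
  by apply: closed_comp => [x _|]; [exact: (tmap_continuous S)|exact: hset_closed].
have ontoT y : exists x : S, tmap S x = y.
  have : range (tmap S) y by rewrite tmap_surj.
  by case=> x _; exists x.
have B0 : tmap S @^-1` B !=set0.
  have [b Bb] := hset_neq0 B; have [x xb] := ontoT b.
  by exists x; rewrite /preimage /= xb.
exists (Hyperspace cB B0) => //; apply: hyperspace_inj => /=.
apply/seteqP; split => [_ [x ? <-]//|b Bb].
by have [x xb] := ontoT b; exists x; rewrite // /preimage /= xb.
Qed.

Definition hyper_tds : tds R := TDS hmap_continuous hmap_surj.

End induced_system.

Section dynamics.
Context {R : realType} (S : tds R).
Implicit Types (x y : S) (A : set S).

Local Notation T := (tmap S).

Definition orb x : set S := range (fun m => iter m T x).

(* For a closed set A with T(A) included in A: every orbit is dense in A for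
   the relative topology, closures in A and in S being the same.  Surjectivity
   of T on A is then automatic, hence not required. *)
Definition minimal_subsystem A := forall y, A y -> closure (orb y) = A.

Definition minimal_point x := minimal_subsystem (closure (orb x)).

Definition pointwise_minimal := forall x, minimal_point x.

Definition proximal x y := exists2 n : nat -> nat,
  n i @[i --> \oo] --> \oo &
  mdist (iter (n i) T x) (iter (n i) T y) @[i --> \oo] --> (0 : R).

Definition distal := forall x y, proximal x y -> x = y.

(* The supremum is finite since S is compact. *)
Definition diam A : R := sup [set mdist u.1 u.2 | u in A `*` A].

Definition equicontinuous_point x := forall e : R, 0 < e ->
  exists2 d : R, 0 < d & forall n, diam (iter n T @` ball x d) < e.

Definition equicontinuous_tds := forall x, equicontinuous_point x.

End dynamics.

Arguments pointwise_minimal {R} S.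
Arguments distal {R} S.
Arguments equicontinuous_tds {R} S.

(* Main.v *)
(* Let [E] be the Ellis semigroup of the hyperspace system, i.e. the closure of
   the iterates of [T_K] for pointwise convergence. Each of (3) and (4) forces
   every element of [E] to have a left inverse in [E]: under (3) idempotents are
   the identity, as [A] and [u A] are proximal; under (4) idempotents only satisfy
   [A `<=` u A], but those of a minimal left ideal are the identity. Left
   invertibility then gives minimality of all points, and also equicontinuity of
   [T], for otherwise some element of [E] would not be injective. Conversely, an
   equicontinuous surjective system is distal because all pairs of points are
   recurrent. *)
Require Import Defs.
From mathcomp Require Import all_boot all_order all_algebra.
From mathcomp Require Import all_classical all_reals all_analysis.

Set Implicit Arguments.
Unset Strict Implicit.
Unset Printing Implicit Defensive.

Import Order.TTheory GRing.Theory Num.Theory.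
Import numFieldNormedType.Exports.

Local Open Scope classical_set_scope.
Local Open Scope ring_scope.

(** * Minimal closed sets by Zorn's lemma *)

(** Zorn's lemma is applied to the removed sets [U], ordered by inclusion. The predicate [Q] is
    abstract so as to cover both subsemigroups and left ideals. *)
Lemma compact_minimal_closed (T : topologicalType) (Q : set T -> Prop) (A : set T) :
  compact [set: T] ->
  (forall F : set (set T), F `<=` Q -> Q (\bigcap_(X in F) X)) ->
  closed A -> A !=set0 -> Q A ->
  exists M, [/\ M `<=` A, closed M, M !=set0, Q M &
    forall N, N `<=` M -> closed N -> N !=set0 -> Q N -> N = M].
Proof.
move=> cT Qcap cA A0 QA.
have [|U [[cU U0 QU] Umax]] :=
    @Zorn_bigcup T [set U | [/\ closed (A `\` U), A `\` U !=set0 & Q (A `\` U)]].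
  move=> F FP Ftot.
  have Fcap : A `\` \bigcup_(X in F) X =
      \bigcap_(Y in [set A] `|` [set A `\` X | X in F]) Y.
    apply/seteqP; split => [x [Ax nFx] Y [->//|[X FX <-]]|x Fx].
      by split => // Xx; apply: nFx; exists X.
    split; first by apply: Fx; left.
    by move=> [X FX Xx]; have [|_] := Fx (A `\` X); first by right; exists X.
  have Gclosed Y : ([set A] `|` [set A `\` X | X in F]) Y -> closed Y.
    by move=> [->//|[X /FP[+ _ _] <-]].
  have Gtot X Y : ([set A] `|` [set A `\` X | X in F]) X ->
      ([set A] `|` [set A `\` X | X in F]) Y -> X `<=` Y \/ Y `<=` X.
    move=> [->|[X' FX <-]] [->|[Y' FY <-]]; [by left|by right=> ? []|by left=> ? []|].
    by have [XY|YX] := Ftot _ _ FX FY; [right|left] => x [Ax nx]; split => // ?;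
      apply: nx; [exact: XY|exact: YX].
  rewrite /= Fcap; split.
  - by apply: closed_bigI => Y /Gclosed.
  (* The chain of remainders, with [A] added, is a base of a proper filter; by compactness it has a
     cluster point, which lies in all of them. *)
  - have GF : ProperFilter
        (filter_from ([set A] `|` [set A `\` X | X in F]) (@id (set T))).
      apply: filter_from_proper.
        apply: filter_from_filter; first by exists A; left.
        move=> X Y GX GY; have [XY|YX] := Gtot _ _ GX GY.
          by exists X => // x Xx; split => //; exact: XY.
        by exists Y => // x Yx; split => //; exact: YX.
      by move=> X [->//|[Y /FP[_ + _] <-]].
    have [x [_ clx]] := cT _ GF filterT.
    exists x => Y GY; apply: (Gclosed _ GY) => B xB.
    by apply: clx => //; exists Y.
  - by apply: Qcap => Y [->//|[X /FP[_ _ +] <-]].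
exists (A `\` U); split => // N NU cN N0 QN.
apply/seteqP; split => // x [Ax nUx]; apply: contrapT => nNx.
have AN : A `\` ~` N = N.
  apply/seteqP; split => [y [_ /contrapT]//|y Ny].
  by split; [have [] := NU y Ny|apply].
apply: (Umax (~` N)); last by rewrite /= AN.
by split => [y Uy /NU[]//|/(_ x nNx)].
Qed.

(** * The Ellis semigroup, its idempotents and its minimal left ideals *)

Section ellis_semigroup.
Context {R : realType} (Y : tds R).
Local Notation T := (tmap Y).
Local Notation P := {ptws Y -> Y}.
Implicit Types (f g p q : P) (x y : Y) (e : R) (M N : set P).

Definition ellis : set P := closure (range (fun n => iter n T : P)).

Lemma ptws_compact : compact [set: P].
Proof.
have := @tychonoff Y (fun _ => Y) (fun _ => setT) (fun _ => @compact_setT R Y).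
by congr compact; apply/seteqP; split.
Qed.

Lemma ptws_hausdorff : hausdorff_space P.
Proof. by apply: hausdorff_product => x; exact: metric_hausdorff. Qed.

Lemma eval_continuous x : continuous (fun f : P => f x).
Proof. exact: (@proj_continuous Y (fun _ => Y)). Qed.

Lemma compr_continuous g : continuous (fun f : P => (f \o g : P)).
Proof.
move=> f; apply/(pointwise_cvgP _ (fmap_filter _ (nbhs_filter f))) => x.
exact: (@eval_continuous (g x) f).
Qed.

Lemma iter_continuous n : continuous (iter n T).
Proof.
elim: n => [|n IHn] x; first exact: cvg_id.
by apply: continuous_comp; [exact: IHn|exact: tmap_continuous].
Qed.

Lemma compl_iter_continuous n : continuous (fun f : P => (iter n T \o f : P)).
Proof.
move=> f; apply/(pointwise_cvgP _ (fmap_filter _ (nbhs_filter f))) => x.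
apply: (@continuous_comp _ _ _ (fun h : P => h x) (iter n T) f).
  exact: eval_continuous.
exact: iter_continuous.
Qed.

Lemma closed_image_compr M g : closed M -> closed ((fun f : P => (f \o g : P)) @` M).
Proof.
move=> cM; apply: compact_closed; first exact: ptws_hausdorff.
apply: continuous_compact; first exact/continuous_subspaceT/compr_continuous.
exact: subclosed_compact cM ptws_compact _.
Qed.

Lemma closed_compr_eq M g h : closed M -> closed [set f | M f /\ (f \o g : P) = h].
Proof.
move=> cM; apply: closedI => //.
have ch : closed [set h] by exact: compact_closed ptws_hausdorff (@compact_set1 _ h).
exact: ((continuous_closedP _).1 (@compr_continuous g) _ ch).
Qed.

Lemma ellis_closed : closed ellis. Proof. exact: closed_closure. Qed.

Lemma ellis_iter n : ellis (iter n T).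
Proof. by apply: subset_closure; exists n. Qed.

(** Composition is continuous in the left factor, but in the right one only if the left factor is a
    continuous map. So [f] is first reduced to an iterate, and only then [g]. *)
Lemma ellis_comp f g : ellis f -> ellis g -> ellis (f \o g).
Proof.
move=> Ef Eg.
have sub (h : P -> P) : continuous h ->
    (forall n, ellis (h (iter n T))) -> forall k, ellis k -> ellis (h k).
  move=> ch hE k; apply: (_ : closure _ `<=` h @^-1` ellis).
  have /closure_id -> : closed (h @^-1` ellis).
    exact: ((continuous_closedP _).1 ch _ ellis_closed).
  by apply: closureS => _ [n _ <-]; exact: hE.
apply: (sub _ (@compr_continuous g)) => // n.
apply: (sub _ (@compl_iter_continuous n)) => // m.
have -> : (iter n T \o iter m T : P) = iter (n + m) T by apply/funext => x /=; rewrite iterD.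
exact: ellis_iter.
Qed.

Lemma near_ptws_seq f (s : seq Y) e : 0 < e ->
  \forall g \near f, forall x, x \in s -> mdist (f x) (g x) < e.
Proof.
have ? : Filter (nbhs f) := nbhs_filter f.
move=> e0; elim: s => [|x s IHs]; first by apply: filterS filterT => g _ x; rewrite in_nil.
have fx : nbhs f [set g | mdist (f x) (g x) < e].
  by have := @eval_continuous x f _ (nbhsx_ballx (f x) e e0); rewrite ballEmdist.
apply: filterS (filterI fx IHs) => g [gx gs] y.
by rewrite inE => /predU1P[->|]; [exact: gx|exact: gs].
Qed.

Lemma ellis_approx f (s : seq Y) e : ellis f -> 0 < e ->
  exists n, forall x, x \in s -> mdist (f x) (iter n T x) < e.
Proof.
by move=> Ef e0; have [_ [[n _ <-] fn]] := Ef _ (near_ptws_seq f s e0); exists n.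
Qed.

(** The right-hand side is the image of a compact set under evaluation at [x], hence closed. *)
Lemma closure_orbE x : closure (orb x) = [set f x | f in ellis].
Proof.
apply/seteqP; split; last first.
  move=> _ [f Ef <-] B fB.
  have [_ [[n _ <-] Bn]] := Ef _ (eval_continuous fB).
  by exists (iter n T x); split => //; exists n.
have /closure_id -> : closed [set f x | f in ellis].
  apply: compact_closed; first exact: metric_hausdorff.
  apply: continuous_compact; first exact/continuous_subspaceT/eval_continuous.
  exact: subclosed_compact ellis_closed ptws_compact _.
by apply: closureS => _ [n _ <-]; exists (iter n T) => //; exact: ellis_iter.
Qed.

Definition comp_closed M := forall f g, M f -> M g -> M (f \o g).

(* Ellis-Numakura: in a minimal closed subsemigroup [M], for any [s] in [M],
   both [M s] and [{f in M | f s = s}] are closed subsemigroups. *)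
Lemma exists_idempotent M : closed M -> M !=set0 -> comp_closed M ->
  exists2 u, M u & (u \o u : P) = u.
Proof.
move=> cM M0 CM.
have [|L [LM cL [s Ls] CL Lmin]] := compact_minimal_closed ptws_compact _ cM M0 CM.
  by move=> F FC f g Ff Fg X FX; apply: FC => //; [exact: Ff|exact: Fg].
have LsE : [set (f \o s : P) | f in L] = L.
  apply: Lmin.
  - by move=> _ [f Lf <-]; exact: CL.
  - exact: closed_image_compr.
  - by exists (s \o s); exists s.
  - move=> _ _ [f Lf <-] [g Lg <-]; exists ((f \o s) \o g) => //.
    by apply: (CL) => //; exact: CL.
have LsE' : [set f | L f /\ (f \o s : P) = s] = L.
  apply: Lmin.
  - by move=> f [].
  - exact: closed_compr_eq.
  - by move: Ls; rewrite -[X in X s]LsE => -[f Lf fs]; exists f.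
  - move=> f g [Lf fs] [Lg gs]; split; first exact: CL.
    by rewrite -[RHS]fs -[in RHS]gs.
by exists s; [exact: LM|move: Ls; rewrite -[X in X s]LsE' => -[]].
Qed.

Definition left_ideal M := forall f g, ellis f -> M g -> M (f \o g).

Lemma left_ideal_comp M : M `<=` ellis -> left_ideal M -> comp_closed M.
Proof. by move=> ME LM f g /ME Ef; exact: LM. Qed.

Definition ellis_compr p : set P := [set (f \o p : P) | f in ellis].

Lemma ellis_compr_closed p : closed (ellis_compr p).
Proof. exact/closed_image_compr/ellis_closed. Qed.

Lemma ellis_compr_sub p : ellis p -> ellis_compr p `<=` ellis.
Proof. by move=> Ep _ [f Ef <-]; exact: ellis_comp. Qed.

Lemma ellis_compr_neq0 p : ellis_compr p !=set0.
Proof. by exists (iter 0 T \o p), (iter 0 T) => //; exact: ellis_iter. Qed.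

Lemma ellis_compr_ideal p : left_ideal (ellis_compr p).
Proof. by move=> f _ Ef [g Eg <-]; exists (f \o g) => //; exact: ellis_comp. Qed.

(** Working inside [ellis_compr p] gives each member of the ideal the form [q \o p], which later
    yields a left inverse of [p]. *)
Lemma minimal_left_ideal p : exists M, [/\ M `<=` ellis_compr p, closed M, M !=set0,
  left_ideal M & forall N, N `<=` M -> closed N -> N !=set0 -> left_ideal N -> N = M].
Proof.
apply: compact_minimal_closed.
- exact: ptws_compact.
- by move=> F FC f g Ef Fg X FX; apply: FC => //; exact: Fg.
- exact: ellis_compr_closed.
- exact: ellis_compr_neq0.
- exact: ellis_compr_ideal.
Qed.

(** The left ideal [ellis_compr v] lies in [M], so it is [M]; hence [u = f \o v] for some [f], and a
    second factor [v] is absorbed. *)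
Lemma minimal_ideal_idempotent M u v : M `<=` ellis ->
  (forall N, N `<=` M -> closed N -> N !=set0 -> left_ideal N -> N = M) ->
  left_ideal M -> M u -> M v -> (v \o v : P) = v -> (u \o v : P) = u.
Proof.
move=> ME Mmin LM Mu Mv vv.
have EvM : ellis_compr v = M.
  apply: Mmin.
  - by move=> _ [f Ef <-]; exact: LM.
  - exact: ellis_compr_closed.
  - exact: ellis_compr_neq0.
  - exact: ellis_compr_ideal.
move: Mu; rewrite -EvM => -[f _ <-].
by rewrite -[in RHS]vv.
Qed.

Definition ellis_left_invertible :=
  forall p, ellis p -> exists2 q, ellis q & forall x, q (p x) = x.

End ellis_semigroup.

Arguments ellis {R Y}.

(** * Proximality, distality and equicontinuity of a general system *)

Section distality.
Context {R : realType} (Y : tds R).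
Local Notation T := (tmap Y).
Local Notation P := {ptws Y -> Y}.
Implicit Types (x y : Y) (e : R) (p q u : P).

Lemma eq_of_mdist_lt x y : (forall e, 0 < e -> mdist x y < e) -> x = y.
Proof.
move=> xy; apply: mdist_positivity; apply/eqP; rewrite eq_le mdist_ge0 andbT.
by apply/ler_addgt0Pl => e /xy/ltW; rewrite addr0.
Qed.

Lemma iter_unif n e : 0 < e -> exists2 d : R, 0 < d &
  forall x y, mdist x y < d -> mdist (iter n T x) (iter n T y) < e.
Proof.
elim: n e => [|n IHn] e e0; first by exists e.
have [d d0 dT] := tmap_unif Y e0; have [r r0 rT] := IHn d d0.
by exists r => // x y /rT/dT.
Qed.

(** A close time [n] may be small; uniform continuity of [T^k] turns a sufficiently close one into
    the close time [k + n]. *)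
Lemma proximal_of_inf x y :
  (forall e, 0 < e -> exists n, mdist (iter n T x) (iter n T y) < e) ->
  proximal x y.
Proof.
move=> xy.
have /choice[n nP] k : exists n, (k <= n)%N /\
    mdist (iter n T x) (iter n T y) < k.+1%:R^-1.
  have [d d0 dT] := @iter_unif k k.+1%:R^-1 ltac:(by rewrite invr_gt0).
  have [m /dT xym] := xy d d0; exists (k + m)%N.
  by rewrite leq_addr !iterD.
exists n.
  apply/cvgnyPge => A; exists A => // k /= Ak.
  exact: leq_trans Ak (nP k).1.
apply: (@squeeze_cvgr _ _ _ _ (fun=> 0) (fun k : nat => k.+1%:R^-1)).
- by apply: nearW => k; rewrite mdist_ge0 ltW//; exact: (nP k).2.
- exact: cvg_cst.
- exact: cvg_harmonic.
Qed.

Lemma proximal_lt x y N e : proximal x y -> 0 < e ->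
  exists2 n, (N <= n)%N & mdist (iter n T x) (iter n T y) < e.
Proof.
move=> [n /cvgnyPge/(_ N) nN /cvgrPdist_lt/(_ e)/[apply] nxy].
have [k [Nk]] := filter_ex (filterI nN nxy).
by rewrite /= sub0r normrN ger0_norm ?mdist_ge0// => kxy; exists (n k).
Qed.

(** Since [u] sends [x] and [u x] to the same point, an iterate approximating [u] at both brings
    them together. *)
Lemma idempotent_proximal u x : ellis u -> (u \o u : P) = u -> proximal x (u x).
Proof.
move=> Eu uu; apply: proximal_of_inf => e e0.
have e20 : 0 < e / 2 by rewrite divr_gt0.
have [n nP] := ellis_approx [:: x; u x] Eu e20; exists n.
have uux : u (u x) = u x by rewrite -[in RHS]uu.
rewrite (le_lt_trans (metric_triangle _ (u x) _))// [e]splitr ltrD//.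
  by rewrite metric_sym nP// inE eqxx.
by rewrite -{1}uux nP// !inE eqxx orbT.
Qed.

(** The closed semigroup [ellis_compr p] contains an idempotent [q \o p]; distality makes it the
    identity. *)
Lemma distal_ellis_left_invertible : distal Y -> ellis_left_invertible Y.
Proof.
move=> dY p Ep.
have [|_ [q Eq <-] qpqp] := exists_idempotent (ellis_compr_closed (p := p))
    (ellis_compr_neq0 p).
  by apply: left_ideal_comp; [exact: (ellis_compr_sub Ep)|exact: ellis_compr_ideal].
exists q => // x; apply/esym/dY.
by apply: (@idempotent_proximal (q \o p)) => //; exact: ellis_comp.
Qed.

(** Any [f x] equals [(f \o q) (p x)], so [x] and [p x] have the same orbit closure. *)
Lemma ellis_left_invertible_minimal :
  ellis_left_invertible Y -> pointwise_minimal Y.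
Proof.
move=> inv x y; rewrite !closure_orbE => -[p Ep <-].
have [q Eq qp] := inv p Ep.
apply/seteqP; split => _ [f Ef <-].
  by exists (f \o p) => //; exact: ellis_comp.
by exists (f \o q); [exact: ellis_comp|rewrite /= qp].
Qed.

Lemma mdist_le_diam (A : set Y) x y : A x -> A y -> mdist x y <= diam A.
Proof.
move=> Ax Ay; apply: ub_le_sup; last by exists (x, y).
have [M _ MP] := @compact_metric_bounded R Y.
by exists M => _ [u _ <-]; exact/ltW/MP.
Qed.

Lemma diam_le (A : set Y) e : A !=set0 ->
  (forall x y, A x -> A y -> mdist x y <= e) -> diam A <= e.
Proof.
move=> [a Aa] Ae; apply: ge_sup; first by exists (mdist a a), (a, a).
by move=> _ [[x y] [Ax Ay] <-]; exact: Ae.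
Qed.

Definition uniformly_equicontinuous := forall e, 0 < e -> exists2 d : R, 0 < d &
  forall x y, mdist x y < d -> forall n, mdist (iter n T x) (iter n T y) < e.

Lemma equicontinuous_unif : equicontinuous_tds Y -> uniformly_equicontinuous.
Proof.
move=> eqY e e0.
have /compact_near_coveringP := @compact_setT R Y.
move=> /(_ _ (0^'+ : set_system R) (fun d x => forall y, mdist x y < d ->
  forall n, mdist (iter n T x) (iter n T y) < e)) H.
have : \forall d \near 0^'+, [set: Y] `<=` (fun x => forall y, mdist x y < d ->
    forall n, mdist (iter n T x) (iter n T y) < e).
  apply: H => x _; have [r r0 rT] := eqY x e e0.
  have r20 : 0 < r / 2 by rewrite divr_gt0.
  exists (ball x (r / 2), [set d | d < r / 2]) => /=.
    by split; [exact: nbhsx_ballx|exact: nbhs_right_lt].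
  move=> [z d]/= []; rewrite ballEmdist /= => xz dr y zy n.
  rewrite (le_lt_trans _ (rT n))//; apply: mdist_le_diam.
    exists z => //; rewrite ballEmdist /=.
    by rewrite (lt_le_trans xz)// ler_pdivrMr// ler_pMr// ler1n.
  exists y => //; rewrite ballEmdist /=.
  by rewrite (le_lt_trans (metric_triangle _ z _))// [r]splitr ltrD// (lt_trans zy).
move=> /(filterI (nbhs_right_gt (0 : R))) /filter_ex[d [/= d0 dT]].
by exists d => // x y; exact: dT.
Qed.

Lemma unif_equicontinuous : uniformly_equicontinuous -> equicontinuous_tds Y.
Proof.
move=> ueq x e e0; have e20 : 0 < e / 2 by rewrite divr_gt0.
have [d d0 dT] := ueq _ e20.
have d20 : 0 < d / 2 by rewrite divr_gt0.
exists (d / 2) => // n.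
rewrite (@le_lt_trans _ _ (e / 2))//; last by rewrite ltr_pdivrMr// ltr_pMr// ltr1n.
apply: diam_le.
  by exists (iter n T x), x => //; exact: ballxx.
move=> _ _ [y + <-] [z + <-]; rewrite ballEmdist /= => xy xz.
apply/ltW/dT; rewrite (le_lt_trans (metric_triangle _ x _))// [d]splitr ltrD//.
by rewrite metric_sym.
Qed.

Lemma iter_surj n y : exists x, iter n T x = y.
Proof.
elim: n y => [|n IHn] y; first by exists y.
have : range T y by rewrite tmap_surj.
by move=> [z _ <-]; have [x <-] := IHn z; exists x.
Qed.

(* Pigeonhole on a backward orbit of [(x, y)]: if its [j]-th and [k]-th points
   are close, then applying [T^k] shows that [(x, y)] is close to its image
   under [T^(k - j)]. *)
Lemma equicontinuous_recurrent x y N e : uniformly_equicontinuous -> 0 < e ->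
  exists2 n, (N <= n)%N & mdist (iter n T x) x < e /\ mdist (iter n T y) y < e.
Proof.
move=> ueq e0; have [d d0 dT] := ueq _ e0.
have d20 : 0 < d / 2 by rewrite divr_gt0.
have /choice[a aP] k := iter_surj k x.
have /choice[b bP] k := iter_surj k y.
have cYY : compact [set: Y * Y].
  by rewrite -setXTT; apply: compact_setX; exact: compact_setT.
have [[a' b'] [_ clu]] := cYY ((fun k => (a k, b k)) @ \oo) _ filterT.
have nU : nbhs (a', b') (ball a' (d / 2) `*` ball b' (d / 2)).
  by exists (ball a' (d / 2), ball b' (d / 2)) => //; split; exact: nbhsx_ballx.
have late m : exists2 k, (m <= k)%N & mdist a' (a k) < d / 2 /\ mdist b' (b k) < d / 2.
  have [|_ [[k mk <-] []]] := clu [set (a k, b k) | k in [set k | (m <= k)%N]] _ _ nU.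
    by exists m => // k mk; exists k.
  by rewrite !ballEmdist /=; exists k.
have [j _ [aj bj]] := late 0%N; have [k jk [ak bk]] := late (j + N)%N.
have jk' : (j <= k)%N by rewrite (leq_trans _ jk)// leq_addr.
exists (k - j)%N; first by rewrite leq_subRL.
have close (c : nat -> Y) (c' z : Y) : (forall i, iter i T (c i) = z) ->
    mdist c' (c j) < d / 2 -> mdist c' (c k) < d / 2 -> mdist (iter (k - j) T z) z < e.
  move=> cP cj ck; rewrite -{1}(cP j) -iterD subnK// -(cP k); apply: dT.
  rewrite (le_lt_trans (metric_triangle _ c' _))// [d]splitr ltrD//.
  by rewrite metric_sym.
by split; [exact: close aP aj ak|exact: close bP bj bk].
Qed.

(** Once a proximal pair is very close, at time [N], it stays close; at a common return time
    [n >= N] both points are also near where they started. *)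
Lemma equicontinuous_distal : equicontinuous_tds Y -> distal Y.
Proof.
move=> /equicontinuous_unif ueq x y xy; apply: eq_of_mdist_lt => e e0.
have e40 : 0 < e / 2 / 2 by rewrite !divr_gt0.
have [d d0 dT] := ueq _ e40.
have [N _ /dT xyN] := proximal_lt 0 xy d0.
have [n Nn [nx ny]] := equicontinuous_recurrent x y N ueq e40.
have nxy : mdist (iter n T x) (iter n T y) < e / 2 / 2.
  by rewrite -(subnK Nn) !iterD; exact: xyN.
rewrite (le_lt_trans (metric_triangle _ (iter n T y) _))// [e]splitr ltrD//.
  rewrite (le_lt_trans (metric_triangle _ (iter n T x) _))// [e / 2]splitr ltrD//.
  by rewrite metric_sym.
by rewrite (lt_trans ny)// ltr_pdivrMr// ltr_pMr ?ltr1n// divr_gt0.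
Qed.

End distality.

(** * Dynamics of the hyperspace system *)

Section hyperspace_dynamics.
Context {R : realType} (S : tds R).
Local Notation T := (tmap S).
Local Notation K := (hyper_tds S).
Local Notation TK := (tmap K).
Implicit Types (x y : S) (A B C : K) (e : R) (p q : {ptws K -> K}).

Lemma hset_iter n A : hset (iter n TK A) = iter n T @` hset A.
Proof.
elim: n => [|n IHn] /=; first by rewrite image_id.
by rewrite IHn image_comp.
Qed.

Lemma mdistK_lt A B e : mdist A B < e ->
  hset A `<=` fatten (hset B) e /\ hset B `<=` fatten (hset A) e.
Proof. by move=> /hausdorff_dist_lt[]. Qed.

Lemma mdistK_le A B e : 0 < e -> hset A `<=` fatten (hset B) e ->
  hset B `<=` fatten (hset A) e -> mdist A B <= e.
Proof. exact: hausdorff_dist_le. Qed.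

Lemma closed_set1K x : closed [set x].
Proof. exact: compact_closed (@metric_hausdorff _ S) (@compact_set1 _ x). Qed.

Definition hsing x : K := Hyperspace (@closed_set1K x) (ex_intro _ x erefl).

Lemma closed_set2K x y : closed [set x; y].
Proof. by apply: closedU; exact: closed_set1K. Qed.

Definition hpair x y : K :=
  Hyperspace (@closed_set2K x y) (ex_intro _ x (or_introl erefl)).

Lemma uniformly_equicontinuous_hyper :
  uniformly_equicontinuous S -> uniformly_equicontinuous K.
Proof.
move=> ueq e e0; have e20 : 0 < e / 2 by rewrite divr_gt0.
have [d d0 dT] := ueq _ e20; exists d => // A B /mdistK_lt[AB BA] n.
rewrite (@le_lt_trans _ _ (e / 2))//; last by rewrite ltr_pdivrMr// ltr_pMr// ltr1n.
apply: mdistK_le => //; rewrite !hset_iter => _ [x xP <-].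
- by have [b Bb bx] := AB _ xP; exists (iter n T b); [exists b|exact: dT].
- by have [b Bb bx] := BA _ xP; exists (iter n T b); [exists b|exact: dT].
Qed.

(** Direct images preserve inclusion, which survives Hausdorff limits of closed sets. *)
Lemma ellis_mono p A B : ellis p -> hset A `<=` hset B ->
  hset (p A) `<=` hset (p B).
Proof.
move=> Ep AB x pAx; apply: (closed_fatten (hset_closed (p B))) => e e0.
have e20 : 0 < e / 2 by rewrite divr_gt0.
have [n nP] := ellis_approx [:: A; B] Ep e20.
have [pA _] := mdistK_lt (nP _ (mem_head _ _)).
have [_ pB] := mdistK_lt (nP B ltac:(by rewrite !inE eqxx orbT)).
rewrite [e]splitr; apply: (fatten_trans _ pB) pAx => y /pA[a + ay].
rewrite hset_iter => -[z Az za]; exists a => //.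
by rewrite hset_iter; exists z => //; exact: AB.
Qed.

(** Iterates of [hsing x] are singletons, and so are their Hausdorff limits. *)
Lemma closure_orb_hsing x C y z : closure (orb (hsing x)) C ->
  hset C y -> hset C z -> y = z.
Proof.
rewrite closure_orbE => -[p Ep <-] py pz; apply: eq_of_mdist_lt => e e0.
have e20 : 0 < e / 2 by rewrite divr_gt0.
have [n nP] := ellis_approx [:: hsing x] Ep e20.
have [pn _] := mdistK_lt (nP _ (mem_head _ _)).
have [a + ya] := pn _ py; rewrite hset_iter => -[_ -> ax].
have [b + zb] := pn _ pz; rewrite hset_iter => -[_ -> bx].
rewrite -ax in ya; rewrite -bx in zb.
by rewrite (le_lt_trans (metric_triangle _ (iter n T x) _))// [e]splitr ltrD// metric_sym.
Qed.

Lemma minimal_refl (Y : tds R) (x y : Y) : minimal_point x ->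
  closure (orb x) y -> closure (orb y) x.
Proof.
by move=> xmin /xmin ->; apply: subset_closure; exists 0%N.
Qed.

(** If [u] sends [{x}] to [{y}], it fixes [{y}], so the orbit closure of [{x, y}] contains [{y}]. By
    minimality [{x, y}] is in the orbit closure of [{y}], where all sets are singletons. Thus
    [x = y], and monotonicity of [u] concludes. *)
Lemma idempotent_extensive u A : pointwise_minimal K -> ellis u ->
  (u \o u : {ptws K -> K}) = u -> hset A `<=` hset (u A).
Proof.
move=> minK Eu uu x Ax.
have [y uy] := hset_neq0 (u (hsing x)).
have uxE : u (hsing x) = hsing y.
  apply: hyperspace_inj; apply/seteqP; split => [z uz|_ ->//].
  by apply: closure_orb_hsing uz uy; rewrite closure_orbE; exists u.
have uyE : u (hsing y) = hsing y by rewrite -uxE -[in RHS]uu.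
have Dy : closure (orb (hpair x y)) (hsing y).
  move=> B /nbhs_ballP[e /= e0 eB].
  have e20 : 0 < e / 2 by rewrite divr_gt0.
  have [n nP] := ellis_approx [:: hsing x; hsing y] Eu e20.
  exists (iter n TK (hpair x y)); split; first by exists n.
  apply: eB; rewrite ballEmdist /=.
  rewrite (@le_lt_trans _ _ (e / 2))//; last by rewrite ltr_pdivrMr// ltr_pMr// ltr1n.
  have [x1 x2] := mdistK_lt (nP _ (mem_head _ _)).
  have [y1 y2] := mdistK_lt (nP (hsing y) ltac:(by rewrite !inE eqxx orbT)).
  rewrite uxE hset_iter [hset _]/= image_set1 in x1 x2.
  rewrite uyE hset_iter [hset _]/= image_set1 in y1 y2.
  apply: mdistK_le; rewrite // hset_iter.
    move=> z /x1[_ -> xz]; exists (iter n T x) => //.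
    by exists x => //; left.
  by move=> _ [_ [->|->] <-]; [exact: x2|exact: y2].
have xy : x = y.
  by apply: (closure_orb_hsing (minimal_refl (minK _) Dy)); [left|right].
apply: (@ellis_mono u (hsing x) A Eu) => [_ ->//|].
by rewrite uxE xy.
Qed.

(* For an idempotent [w] of the minimal ideal fixing [A], [u A] lies between
   [A] and [w (u A) = w A = A]. *)
Lemma minimal_ellis_left_invertible :
  pointwise_minimal K -> ellis_left_invertible K.
Proof.
move=> minK p Ep.
have [M [Mp cM M0 LM Mmin]] := minimal_left_ideal p.
have ME : M `<=` ellis by apply: subset_trans Mp (ellis_compr_sub Ep).
have [u Mu uu] := exists_idempotent cM M0 (left_ideal_comp ME LM).
have [q Eq qpu] := Mp _ Mu.
exists q => // A; have -> : q (p A) = u A by rewrite -qpu.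
have [m Mm] := M0.
(* By minimality of [A], some [f] brings [m A] back to [A]; so [f \o m] is a member of [M] fixing
   [A]. *)
have [f Ef fmA] : [set f (m A) | f in ellis] A.
  rewrite -closure_orbE; apply: minimal_refl => //.
  by rewrite closure_orbE; exists m => //; exact: ME.
have [||| w [Mw wA] ww] := @exists_idempotent _ K [set g | M g /\ g A = A].
- apply: closedI => //.
  exact: ((continuous_closedP _).1 (@eval_continuous _ K A) _
    (compact_closed (@metric_hausdorff _ K) (@compact_set1 _ A))).
- by exists (f \o m); split => //; exact: LM.
- move=> g h [Mg gA] [Mh hA]; split; first exact: left_ideal_comp.
  by rewrite /= hA.
have wu : (w \o u : {ptws K -> K}) = w by exact: minimal_ideal_idempotent Mu uu.
apply: hyperspace_inj; apply/seteqP; split.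
  rewrite -[X in _ `<=` hset X]wA -[in X in _ `<=` hset X]wu.
  exact: idempotent_extensive (ME _ Mw) ww.
exact: idempotent_extensive (ME _ Mu) uu.
Qed.

Lemma closed_cball x e : closed [set y | mdist x y <= e].
Proof.
move=> y cy; apply/ler_addgt0Pl => r r0.
have [z [/= xz]] := cy _ (nbhsx_ballx y r r0); rewrite ballEmdist /= => yz.
by rewrite (le_trans (metric_triangle _ z _))// addrC lerD// ltW// metric_sym.
Qed.

Lemma cball_neq0 x e : 0 <= e -> [set y | mdist x y <= e] !=set0.
Proof. by move=> e0; exists x; rewrite /= mdistxx. Qed.

(** Closed balls, since open ones need not be points of the hyperspace. *)
Definition hcball x m : K :=
  Hyperspace (@closed_cball x m.+1%:R^-1) (@cball_neq0 x m.+1%:R^-1 ltac:(by [])).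

Lemma hcball_le x m k : (m <= k)%N -> hset (hcball x k) `<=` hset (hcball x m).
Proof.
move=> mk y /= /le_trans; apply.
by rewrite lef_pV2 ?posrE// ler_nat.
Qed.

Lemma hcball_bigcap x y : (forall m, hset (hcball x m) y) -> y = x.
Proof.
move=> xy; apply/esym/eq_of_mdist_lt => e e0.
have [m _ /(_ m (leqnn m))] := (@cvgrPdist_lt _ _ _ _ _ _ _).1 (@cvg_harmonic R) e e0.
by rewrite /= sub0r normrN ger0_norm//; apply: le_lt_trans; exact: xy.
Qed.

(* If [T^(n_k)] expands the [1/(k+1)]-balls at [x] by [e], take a cluster point
   [p] of the [n_k]-th iterates and a cluster point [B] of the images under [p] of
   the closed balls at [x]. A left inverse [q] of [p] sends both [B] and [p {x}] to
   [{x}], so [B = p {x}] is a singleton, although the sets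
   [T^(n_k) (ball x (1/(k+1)))] have diameter at least [e]. *)
Lemma ellis_left_invertible_equicontinuous :
  ellis_left_invertible K -> equicontinuous_tds S.
Proof.
move=> inv x e e0; apply: contrapT => neq.
have /choice[n_ nP] k : exists n, ~ diam (iter n T @` ball x k.+1%:R^-1) < e.
  apply: contrapT => /forallNP h; apply: neq; exists k.+1%:R^-1 => // n.
  exact: contrapT (h n).
have [p [_ clp]] := @ptws_compact _ K ((fun k => iter (n_ k) TK) @ \oo) _ filterT.
have Ep : ellis p.
  move=> U /(clp (range (fun n => iter n TK))); apply.
  by exists 0%N => // k _; exists (n_ k).
(* As [q] is itself in [ellis], it has a left inverse [r] and is therefore injective. *)
have [q Eq qp] := inv p Ep; have [r _ rq] := inv q Eq.
have [B [_ clB]] := @compact_setT R K ((fun m => p (hcball x m)) @ \oo) _ filterT.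
(* The sets [p (hcball x k)] decrease with [k], so their cluster point lies in each of them. *)
have Bp m : hset B `<=` hset (p (hcball x m)).
  move=> y By; apply: (closed_fatten (hset_closed _)) => d d0.
  have [|_ [[k mk <-]]] := clB [set p (hcball x k) | k in [set k | (m <= k)%N]] _ _
      (nbhsx_ballx B d d0).
    by exists m => // k mk; exists k.
  rewrite ballEmdist => /mdistK_lt[/(_ y By)[z zk zy] _]; exists z => //.
  exact: ellis_mono Ep (hcball_le mk) _ zk.
have qBx y : hset (q B) y -> y = x.
  move=> qBy; apply: hcball_bigcap => m; rewrite -(qp (hcball x m)).
  exact: ellis_mono Eq (Bp m) _ qBy.
have qB : q B = hsing x.
  apply: hyperspace_inj; apply/seteqP; split => [y /qBx//|_ ->].
  by have [y qBy] := hset_neq0 (q B); rewrite -(qBx y qBy).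
have BE : B = p (hsing x) by rewrite -[LHS]rq qB -[in LHS](qp (hsing x)) rq.
have B1 y z : hset B y -> hset B z -> y = z.
  apply: (@closure_orb_hsing x); rewrite BE closure_orbE; exists p => //.
(* Two approximations, each costing [d], put the expanded ball within [e / 4] of the single point of
   [B], so its diameter is at most [e / 2]. *)
pose d := e / 2 / 2 / 2.
have d0 : 0 < d by rewrite !divr_gt0.
have [|_ [[m _ <-]]] := clB (range (fun m => p (hcball x m))) _ _ (nbhsx_ballx B d d0).
  by exists 0%N => // m _; exists m.
rewrite ballEmdist /= metric_sym => /mdistK_lt[mB _].
(* With [m] fixed first, [k >= m] ensures that the ball expanded by [T^(n_ k)] lies in
   [hcball x m]. *)
have [|_ [[k mk <-]]] := clp [set iter (n_ k) TK | k in [set k | (m <= k)%N]] _ _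
    (near_ptws_seq p [:: hcball x m] d0).
  by exists m => // k mk; exists k.
move=> /(_ _ (mem_head _ _)).
move=> /mdistK_lt[_ km].
have kB : hset (iter (n_ k) TK (hcball x m)) `<=` fatten (hset B) (d + d).
  exact: fatten_trans km mB.
apply: (nP k); rewrite (@le_lt_trans _ _ (e / 2))//; last first.
  by rewrite ltr_pdivrMr// ltr_pMr// ltr1n.
apply: diam_le.
  by exists (iter (n_ k) T x), x => //; exact: ballxx.
have sub y : (iter (n_ k) T @` ball x k.+1%:R^-1) y -> fatten (hset B) (d + d) y.
  move=> [z xz <-]; apply: kB; rewrite hset_iter; exists z => //.
  by apply: hcball_le mk _ _; move: xz; rewrite ballEmdist => /ltW.
move=> y z /sub[b Bb yb] /sub[c Bc zc]; rewrite -(B1 b c Bb Bc) in zc.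
rewrite -splitr in yb zc.
rewrite (le_trans (metric_triangle _ b _))// [e / 2]splitr lerD// ltW//.
by rewrite metric_sym.
Qed.

End hyperspace_dynamics.

Theorem theorem3p4 (R : realType) (S : tds R) :
  [<-> equicontinuous_tds S;
       equicontinuous_tds (hyper_tds S);
       distal (hyper_tds S);
       pointwise_minimal (hyper_tds S)].
Proof.
tfae.
- move=> /equicontinuous_unif ueq.
  exact/unif_equicontinuous/uniformly_equicontinuous_hyper.
- exact: equicontinuous_distal.
- by move=> /distal_ellis_left_invertible; exact: ellis_left_invertible_minimal.
- by move=> /minimal_ellis_left_invertible; exact: ellis_left_invertible_equicontinuous.
Qed.
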